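(* Let $p\ge 100018663$ be a prime and let $b\in\mathbb{F}_{p^4}$ be such that $\mathrm{Tr}_{p^4/p}(b)\neq 0$. Let $f_b(X)=X+\dfrac{1}{X^p-X+b}$. Then $f_b$ is not a permutation rational function of $\mathbb{F}_{p^4}$; that is, the map $\mathbb{F}_{p^4}\to\mathbb{F}_{p^4}$, $x\mapsto x+(x^p-x+b)^{-1}$, is not a bijection.
   Context: $\mathbb{F}_q$ denotes the finite field with $q$ elements, and $\mathrm{Tr}_{p^n/p}:\mathbb{F}_{p^n}\to\mathbb{F}_p$, $\mathrm{Tr}_{p^n/p}(x)=\sum_{i=0}^{n-1}x^{p^i}$, is the trace. Since $\mathrm{Tr}_{p^4/p}(b)\ne0$ and $\mathrm{Tr}_{p^4/p}(x^p-x)=0$, one has $x^p-x+b\neq 0$ for all $x\in\mathbb{F}_{p^4}$, so $f_b$ defines a map $\mathbb{F}_{p^4}\to\mathbb{F}_{p^4}$. A rational function is called a permutation rational function (PR) of $\mathbb{F}_q$ if it induces a permutation of $\mathbb{F}_q$. *)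

(* Defs.v *)
From mathcomp Require Import all_boot all_algebra all_field.
Set Implicit Arguments. Unset Strict Implicit. Unset Printing Implicit Defensive.
Import GRing.Theory.
Local Open Scope ring_scope.

(* Tr_{p^n/p}; when #|F| = p ^ n its values lie in the prime subfield of F,
   and they are kept as elements of F. *)
Definition trace (F : finFieldType) (p n : nat) (x : F) : F :=
  \sum_(i < n) x ^+ (p ^ i).

(* The map induced by X + 1 / (X^p - X + b).  The convention 0^-1 = 0 plays no
   role when b has nonzero trace, by denom_neq0 below. *)
Definition f_b (F : finFieldType) (p : nat) (b x : F) : F :=
  x + (x ^+ p - x + b)^-1.

Lemma denom_neq0 (F : finFieldType) (p n : nat) (b : F) :
    prime p -> #|F| = (p ^ n)%N -> trace p n b != 0 ->
  forall x : F, x ^+ p - x + b != 0.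
Proof.
move=> pr_p cardF trb x; have chF := card_finPcharP cardF pr_p.
apply: contraNneq trb => den0.
have -> : b = - (x ^+ p - x) by apply/eqP; rewrite -addr_eq0 addrC den0.
have expB i :
    (- (x ^+ p - x)) ^+ (p ^ i) = - (x ^+ (p ^ i.+1) - x ^+ (p ^ i)).
  elim: i => [|i IH]; first by rewrite !expn0 !expr1 expn1.
  rewrite [in LHS]expnSr exprM IH -(pFrobenius_autE chF) rmorphN rmorphB /=.
  by rewrite !pFrobenius_autE -!exprM -!expnSr.
rewrite /trace -(big_mkord xpredT (fun i => (- (x ^+ p - x)) ^+ (p ^ i))).
under eq_bigr => i _ do rewrite expB.
rewrite sumrN (telescope_sumr (fun i => x ^+ (p ^ i))) //.
by rewrite -cardF expf_card expn0 expr1 subrr oppr0.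
Qed.

(* Main.v *)
From Stdlib Require PeanoNat.
Require Import Defs.
From mathcomp Require Import all_boot all_algebra all_field ring zify.
Set Implicit Arguments. Unset Strict Implicit. Unset Printing Implicit Defensive.
Import GRing.Theory.
Local Open Scope ring_scope.

(** Write t for the trace of b and, for y with trace t, put
    g(y) = y + y^(-p) - y^(-1).  If y = x^p - x + b then
    f_b(x)^p - f_b(x) = g(y) - b, and by the additive form of Hilbert's
    Theorem 90 every y of trace t arises in this way.  So bijectivity of f_b
    forces g to permute the affine hyperplane S_t of elements of trace t
    (lemma bijective_f_b_hyperplane_map_inj).  Two incompatible consequences
    are drawn from this.

    On the one hand, the sum of g(y)^2 over S_t equals the sum of y^2.  After
    expansion only four power sums of y^(-1) remain.  By homogeneity, a sum
    over S_t is minus the sum of a function of degree 0 over all nonzero y;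
    apart from a term that sums to 0, this function is a polynomial of degree
    below q - 1, where q is the order of the field, and its sum is read off from
    its constant term.  The outcome is 2 t^2 = 2, so t^2 = 1
    (hyperplane_map_inj_trace_sq).

    On the other hand, if t^2 = 1 then g identifies two points of S_t that lie
    in the quadratic subfield (hyperplane_map_collision).  For u1, u2 in that
    subfield with conjugates v1, v2, both of relative trace t/2, the equation
    g(u1) = g(u2) says that u1 u2 + 1 has relative norm 1.  Parametrizing the
    conic that occurs in this condition by r in the prime field, what remains
    is that the quartic
      (7 r^2 + 9 c)^2 - 48 (r^2 - c)^2 = r^4 + 222 c r^2 + 33 c^2,
    with c a fixed nonsquare, takes a nonsquare value at some r.

    That a quartic X^4 + B X^2 + C with B^2 <> 4 C takes a nonsquare value over
    the prime field (quartic_nonsquare_value) follows from a small instance of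
    Stepanov's method: otherwise h^((p+1)/2) - h is divisible by X^p - X,
    and differentiating twice produces a multiple of X^p - X of degree at most
    10, hence a differential equation for h that only a constant times a
    square satisfies. *)

(** * Degree bounds for polynomials *)

Section PolySize.
Variable R : idomainType.
Implicit Types p q : {poly R}.

Lemma size_polyD_leq k p q :
  (size p <= k)%N -> (size q <= k)%N -> (size (p + q)%R <= k)%N.
Proof. by move=> hp hq; apply: leq_trans (size_polyD p q) _; rewrite geq_max hp. Qed.

Lemma size_polyB_leq k p q :
  (size p <= k)%N -> (size q <= k)%N -> (size (p - q)%R <= k)%N.
Proof. by move=> hp hq; apply: size_polyD_leq; rewrite ?size_polyN. Qed.

Lemma size_polyM_leq i j k p q : (size p <= i)%N -> (size q <= j)%N ->
  (i + j <= k.+1)%N -> (size (p * q)%R <= k)%N.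
Proof. by move=> hp hq hk; have := size_polyMleq p q; lia. Qed.

Lemma size_cofactor_leq k p q : p \is monic ->
  (size (p * q)%R <= (size p).-1 + k)%N -> (size q <= k)%N.
Proof.
move=> mp; have [->|q0] := eqVneq q 0; first by rewrite size_poly0.
have := size_poly_gt0 p; rewrite monic_neq0 // size_monicM // => p0; lia.
Qed.

Lemma monic_mul_small p q r : p \is monic ->
  p * q = r -> (size r < size p)%N -> q = 0.
Proof.
move=> mp; have [->|q0 <-] := eqVneq q 0; first by [].
rewrite size_monicM //; have := size_poly_gt0 q; rewrite q0; lia.
Qed.
End PolySize.

(** * Nonsquare values of quartics over the prime field *)

Section PrimeField.
Variables (F : fieldType) (p : nat).
Hypothesis chF : p \in [pchar F].

Lemma natr_inj_lt : {in iota 0 p &, injective (fun n => n%:R : F)}.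
Proof.
suff H m n : (m <= n)%N -> (n < p)%N -> m%:R = n%:R :> F -> m = n.
  move=> m n; rewrite !mem_iota /= add0n => hm hn e.
  by have [h|/ltnW h] := leqP m n; [apply: H|apply/esym/H].
move=> mn np /eqP; rewrite eq_sym -subr_eq0 -natrB // -(dvdn_pcharf chF).
have [d0|d0 /(dvdn_leq d0)] := posnP (n - m); lia.
Qed.

Lemma size_Xp_subX : size ('X^p - 'X : {poly F}) = p.+1.
Proof.
have p1 := prime_gt1 (pcharf_prime chF).
by rewrite size_polyDl size_polyXn // size_polyN size_polyX; lia.
Qed.

Lemma monic_Xp_subX : ('X^p - 'X : {poly F}) \is monic.
Proof.
have p1 := prime_gt1 (pcharf_prime chF).
rewrite monicE lead_coefDl ?lead_coefXn // size_polyN size_polyX size_polyXn; lia.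
Qed.

Lemma Xp_subX_prod :
  'X^p - 'X = \prod_(c <- [seq n%:R | n <- iota 0 p]) ('X - c%:P) :> {poly F}.
Proof.
rewrite [LHS](@all_roots_prod_XsubC _ _ [seq n%:R | n <- iota 0 p]).
- by rewrite (monicP monic_Xp_subX) scale1r.
- by rewrite size_Xp_subX size_map size_iota.
- apply/allP=> _ /mapP[n _ ->]; rewrite rootE !hornerE.
  by rewrite -(pFrobenius_autE chF) pFrobenius_aut_nat subrr.
- by rewrite uniq_rootsE map_inj_in_uniq ?iota_uniq //; apply: natr_inj_lt.
Qed.

Lemma frobenius_fixedP (c : F) :
  reflect (c ^+ p = c) (c \in [seq n%:R | n <- iota 0 p]).
Proof.
have -> : (c \in [seq n%:R | n <- iota 0 p]) = (c ^+ p - c == 0).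
  by rewrite -root_prod_XsubC -Xp_subX_prod rootE !hornerE.
by rewrite subr_eq0; apply: eqP.
Qed.

Lemma dvdp_Xp_subX (w : {poly F}) : (forall c, c ^+ p = c -> root w c) ->
  exists v, w = ('X^p - 'X) * v.
Proof.
move=> rw; have /dvdpP[v ->] : 'X^p - 'X %| w; last by exists v; rewrite mulrC.
rewrite Xp_subX_prod uniq_roots_dvdp //.
  by apply/allP=> c /frobenius_fixedP/rw.
by rewrite uniq_rootsE map_inj_in_uniq ?iota_uniq //; apply: natr_inj_lt.
Qed.

Lemma size_deriv_leq k (q : {poly F}) :
  (size q <= k.+1)%N -> (size q^`() <= k)%N.
Proof.
have [->|q0] := eqVneq q 0; first by rewrite deriv0 size_poly0.
by have := lt_size_deriv q0; lia.
Qed.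

(** The hypothesis on the values says that each h(c) is zero or a square of the
    prime field.  With W = h^((p+1)/2) - h = R V and R = X^p - X, the identity
    2 h W' = h' W - h h' (where 2 (p+1)/2 = 1 is used) becomes, as R' = -1,
    R S = h (2 V - h') with S = 2 h V' - h' V.  So S has degree at most 6.
    Differentiating once more gives
    R (3 h' S - 2 h S') = h (2 h h'' - h'^2 - 4 S), whose right-hand side has
    degree at most 10 < p; both sides vanish, and eliminating S leaves the
    conclusion.  It says that S^2 / h^3 has derivative zero, which in such a
    low degree makes h a constant times a square. *)
Lemma quartic_square_values_ode (h : {poly F}) :
  (10 < p)%N -> (size h <= 5)%N ->
  (forall c, c ^+ p = c -> h.[c] ^+ (p./2).+1 = h.[c]) ->
  3 * h^`() * (2 * h * h^`()^`() - h^`() ^+ 2) = 4 * h ^+ 2 * h^`()^`()^`().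
Proof.
move=> p10 sh hK; have prp := pcharf_prime chF.
have op : odd p by case: (even_prime prp) => // p2; rewrite p2 in p10.
have pE : (2 * (p./2).+1 = p.+1)%N by have := odd_double_half p; rewrite op; lia.
set e := p./2 in hK pE.
have chP : p%:R = 0 :> {poly F} by rewrite -polyC_natr (pcharf0 chF).
(* 2 (e + 1) = p + 1 turns the exponent of h into the factor 1/2. *)
have two1 : 2 * e.+1%:R = 1 :> {poly F}.
  by rewrite -natrM pE -addn1 natrD chP add0r.
set R := 'X^p - 'X : {poly F}.
have dR : R^`() = -1.
  by rewrite derivB derivXn derivX -mulr_natr chP mulr0 sub0r.
have [V WE] : exists v, h ^+ e.+1 - h = R * v.
  by apply: dvdp_Xp_subX => c /hK hc; rewrite rootE !hornerE hc subrr.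
have mR : R \is monic := monic_Xp_subX.
have sR : size R = p.+1 := size_Xp_subX.
have sh1 := size_deriv_leq sh; have sh2 := size_deriv_leq sh1.
have ssmall n : (size (n%:R : {poly F}) <= 1)%N.
  by rewrite -polyC_natr size_polyC leq_b1.
have sV : (size V <= p + 3)%N.
  apply: size_cofactor_leq mR _; rewrite -WE sR.
  apply: size_polyB_leq; last by apply: leq_trans sh _; lia.
  apply: leq_trans (size_poly_exp_leq _ _) _.
  have : ((size h).-1 * e.+1 <= 4 * e.+1)%N.
    by rewrite leq_mul2r -subn1 leq_subLR sh orbT.
  by move/leq_ltn_trans; apply; lia.
have [S SE] : exists s, s = 2 * h * V^`() - h^`() * V by exists (2 * h * V^`() - h^`() * V).
have dW : 2 * h * (h ^+ e.+1 - h)^`() = h^`() * (h ^+ e.+1 - h) - h * h^`().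
  rewrite derivB deriv_exp /= exprS -mulr_natr.
  transitivity ((2 * e.+1%:R) * h^`() * (h * h ^+ e) - 2 * h * h^`()); first by ring.
  by rewrite two1; ring.
have E1 : R * S = h * (2 * V - h^`()).
  move: dW; rewrite WE derivM dR => dW.
  apply/eqP; rewrite -subr_eq0; apply/eqP.
  transitivity (2 * h * (-1 * V + R * V^`()) - (h^`() * (R * V) - h * h^`())).
    by rewrite SE; ring.
  by rewrite dW subrr.
have sS : (size S <= 7)%N.
  apply: size_cofactor_leq mR _; rewrite E1 sR.
  apply: (size_polyM_leq sh (j := p + 3)); last by lia.
  apply: size_polyB_leq; last by apply: leq_trans sh1 _; lia.
  by apply: (size_polyM_leq (ssmall 2) sV); lia.
have E2 := congr1 (@deriv F) E1.
rewrite derivM dR derivM derivB derivM in E2.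
have d2 : (2 : {poly F})^`() = 0 by rewrite -polyC_natr derivC.
rewrite d2 mul0r add0r in E2.
have E3 : R * (3 * h^`() * S - 2 * h * S^`()) =
    h * (2 * h * h^`()^`() - h^`() ^+ 2 - 4 * S).
  apply/eqP; rewrite -subr_eq0; apply/eqP.
  transitivity (3 * h^`() * (R * S - h * (2 * V - h^`()))
     - 2 * h * (-1 * S + R * S^`()
          - (h^`() * (2 * V - h^`()) + h * (2 * V^`() - h^`()^`())))).
    by rewrite SE; ring.
  by rewrite E1 E2 !subrr !mulr0 subrr.
have sE3 : (size (h * (2 * h * h^`()^`() - h^`() ^+ 2 - 4 * S))%R < size R)%N.
  rewrite sR; apply: leq_ltn_trans (_ : _ <= 11)%N _; last by lia.
  apply: (size_polyM_leq sh (j := 7)) => //.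
  apply: size_polyB_leq; last by apply: (size_polyM_leq (ssmall 4) sS).
  apply: size_polyB_leq; last by rewrite expr2; apply: (size_polyM_leq sh1 sh1).
  by apply: (size_polyM_leq (i := 5) _ sh2) => //; apply: (size_polyM_leq (ssmall 2) sh).
have E4 := monic_mul_small mR E3 sE3.
move: E3; rewrite E4 mulr0 => /esym/eqP; rewrite mulf_eq0.
have [-> _|h0 /= /eqP S4] := eqVneq h 0; first by rewrite !deriv0; ring.
have d4 : (4 : {poly F})^`() = 0 by rewrite -polyC_natr derivC.
have dS := congr1 (@deriv F) S4; move: dS.
rewrite !(derivB, derivM, deriv0, d2, d4, expr2) => dS.
apply/eqP; rewrite -subr_eq0; apply/eqP.
transitivity (4 * (3 * h^`() * S - 2 * h * S^`())
   + 3 * h^`() * (2 * h * h^`()^`() - h^`() ^+ 2 - 4 * S)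
   - 2 * h * ((0 * h + 2 * h^`()) * h^`()^`() + 2 * h * h^`()^`()^`()
      - (h^`()^`() * h^`() + h^`() * h^`()^`()) - (0 * S + 4 * S^`()))).
  by ring.
by rewrite E4 S4 dS !mulr0 addr0 subrr.
Qed.

(** For h = X^4 + B X^2 + C the two sides of the differential equation
    differ by 24 (4 C - B^2) (X^5 - C X). *)
Lemma quartic_nonsquare_value (B C : F) :
  (10 < p)%N -> B ^+ 2 != 4 * C -> B ^+ p = B -> C ^+ p = C ->
  exists2 r : F, r ^+ p = r & (r ^+ 4 + B * r ^+ 2 + C) ^+ p./2 = -1.
Proof.
move=> p10 BC Bp Cp; have prp := pcharf_prime chF.
have op : odd p by case: (even_prime prp) => // p2; rewrite p2 in p10.
pose h := 'X^4 + B *: 'X^2 + C%:P.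
have hE r : h.[r] = r ^+ 4 + B * r ^+ 2 + C by rewrite !hornerE.
have [/hasP[r /frobenius_fixedP rp hr]|/hasPn nh] :=
  boolP (has (fun r => h.[r] ^+ p./2 == -1) [seq n%:R | n <- iota 0 p]).
  by exists r => //; rewrite -hE (eqP hr).
have hp c : c ^+ p = c -> h.[c] ^+ p = h.[c].
  move=> cp; rewrite hE -(pFrobenius_autE chF) 2!rmorphD (rmorphM _ B) /=.
  by rewrite !pFrobenius_autX !pFrobenius_autE Bp Cp cp.
have hK c : c ^+ p = c -> h.[c] ^+ (p./2).+1 = h.[c].
  move=> cp; have := nh c; rewrite (introT (frobenius_fixedP c) cp) => /(_ isT) hn.
  have [->|h0] := eqVneq h.[c] 0; first by rewrite expr0n.
  have : h.[c] ^+ p./2 ^+ 2 == 1.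
    rewrite -exprM muln2 -(inj_eq (mulfI h0)) -exprS mulr1.
    have -> : (p./2.*2).+1 = p by have := odd_double_half p; rewrite op.
    by rewrite hp.
  by rewrite sqrf_eq1 (negPf hn) orbF exprS => /eqP->; rewrite mulr1.
have sh : (size h <= 5)%N.
  apply: size_polyD_leq; last by rewrite size_polyC; case: eqP.
  apply: size_polyD_leq; first by rewrite size_polyXn.
  by apply: leq_trans (size_scale_leq _ _) _; rewrite size_polyXn.
have := quartic_square_values_ode p10 sh hK.
have d1 : h^`() = 4%:R *: 'X^3 + (B * 2%:R) *: 'X.
  rewrite /h !derivD derivZ !derivXn derivC addr0 /=.
  by rewrite -!scaler_nat scalerA expr1.
have d2 : h^`()^`() = 12%:R *: 'X^2 + (B * 2%:R)%:P.
  rewrite d1 !derivD !derivZ !derivXn derivX /=.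
  by rewrite -!scaler_nat scalerA -natrM alg_polyC.
have d3 : h^`()^`()^`() = 24%:R *: 'X.
  rewrite d2 derivD derivZ derivXn derivC addr0 /= expr1.
  by rewrite -!scaler_nat scalerA -natrM.
rewrite d3 d2 d1 /h => ode; case/negP: BC.
have : 24%:R * (4 * C - B ^+ 2) = 0.
  transitivity ((24%:R * (4 * C - B ^+ 2)) *: ('X^5 - C *: 'X))`_5.
    by rewrite !coefE /= mulr0 subr0 mulr1.
  move/eqP: ode; rewrite -subr_eq0 -!mul_polyC => /eqP ode.
  rewrite -[RHS](coef0 _ 5) -ode; congr (_ : {poly F})`_5.
  by rewrite !(polyCM, polyCB, polyC_exp, polyC_natr); ring.
move/eqP; rewrite mulf_eq0 subr_eq0 -(dvdn_pcharf chF) => /orP[|/eqP->] //.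
rewrite (_ : 24 = 2 ^ 3 * 3)%N // Euclid_dvdM // Euclid_dvdX //= andbT.
by case/orP=> /dvdn_leq; lia.
Qed.
End PrimeField.

(** * Traces and power sums over a hyperplane *)

(** Up to the translation by b, this is the map induced by f_b on the
    differences x^p - x. *)
Definition hyperplane_map (F : finFieldType) (p : nat) (y : F) : F :=
  y + y^-1 ^+ p - y^-1.

Section FiniteField.
Variables (F : finFieldType) (p n : nat).
Hypotheses (pr_p : prime p) (cardF : #|F| = (p ^ n)%N).
Local Notation Tr := (@trace F p n).
Local Notation g := (@hyperplane_map F p).

Let chF : p \in [pchar F] := card_finPcharP cardF pr_p.

Lemma frob_iterD i (x y : F) : (x + y) ^+ (p ^ i) = x ^+ (p ^ i) + y ^+ (p ^ i).
Proof. by rewrite exprDn_pchar // pnatX pnatE // chF. Qed.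

Lemma frob_iterN i (x : F) : (- x) ^+ (p ^ i) = - x ^+ (p ^ i).
Proof.
apply/eqP; rewrite -addr_eq0 -frob_iterD addNr expr0n expn_eq0.
by case: (p) pr_p.
Qed.

Lemma frobN (x : F) : (- x) ^+ p = - x ^+ p.
Proof. by have := frob_iterN 1 x; rewrite expn1. Qed.

Lemma frobD (x y : F) : (x + y) ^+ p = x ^+ p + y ^+ p.
Proof. by have := frob_iterD 1 x y; rewrite expn1. Qed.

Lemma frobB (x y : F) : (x - y) ^+ p = x ^+ p - y ^+ p.
Proof. by rewrite frobD frobN. Qed.

Lemma frob_sum I (r : seq I) (P : pred I) (E : I -> F) :
  (\sum_(i <- r | P i) E i) ^+ p = \sum_(i <- r | P i) E i ^+ p.
Proof.
rewrite -(pFrobenius_autE chF) rmorph_sum /=.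
by apply: eq_bigr => i _; rewrite pFrobenius_autE.
Qed.

Lemma traceD x y : Tr (x + y) = Tr x + Tr y.
Proof. by rewrite /trace -big_split; apply: eq_bigr => i _; rewrite frob_iterD. Qed.

Lemma traceN x : Tr (- x) = - Tr x.
Proof. by rewrite /trace -sumrN; apply: eq_bigr => i _; rewrite frob_iterN. Qed.

Lemma traceB x y : Tr (x - y) = Tr x - Tr y.
Proof. by rewrite traceD traceN. Qed.

Lemma trace0 : Tr 0 = 0.
Proof. by rewrite -[in LHS](subrr 0) traceB subrr. Qed.

Lemma traceZ c x : c ^+ p = c -> Tr (c * x) = c * Tr x.
Proof.
move=> cp; rewrite /trace mulr_sumr; apply: eq_bigr => i _.
rewrite exprMn; congr (_ * _); elim: (val i) => [|j IH]; first by rewrite expn0 expr1.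
by rewrite expnSr exprM IH.
Qed.

Lemma trace_frob x : Tr (x ^+ p) = Tr x.
Proof.
rewrite /trace -(big_mkord xpredT (fun i => (x ^+ p) ^+ (p ^ i))).
rewrite -(big_mkord xpredT (fun i => x ^+ (p ^ i))).
under eq_bigr => i _ do rewrite -exprM -expnS.
apply/eqP; rewrite -subr_eq0 -sumrB (telescope_sumr (fun i => x ^+ (p ^ i))) //.
by rewrite -cardF expf_card expn0 expr1 subrr.
Qed.

Lemma trace_fixed x : Tr x ^+ p = Tr x.
Proof.
rewrite -[RHS]trace_frob /trace frob_sum; apply: eq_bigr => i _.
by rewrite -!exprM mulnC.
Qed.

Lemma card_frobenius_fixed_nz :
  #|[pred c : F | (c ^+ p == c) && (c != 0)]| = p.-1.
Proof.
have p0 := prime_gt0 pr_p.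
have cK : #|[pred c : F | c ^+ p == c]| = p.
  rewrite -[RHS](size_iota 0) -(size_map (fun k => k%:R : F)).
  rewrite -(card_uniqP _); last first.
    by rewrite map_inj_in_uniq ?iota_uniq //; apply: natr_inj_lt.
  by apply: eq_card => c; apply/eqP/(frobenius_fixedP chF).
rewrite -[in RHS]cK [in RHS](cardD1 0) inE expr0n (gtn_eqF p0) eqxx add1n /=.
by apply: eq_card => c; rewrite !inE andbC.
Qed.

Lemma expf_eq1_pred (c : F) : c ^+ p = c -> c != 0 -> c ^+ p.-1 = 1.
Proof.
by move=> cp c0; apply: (mulfI c0); rewrite -exprS prednK ?prime_gt0 // mulr1.
Qed.

Lemma sum_expr k : (k < #|F|.-1)%N -> \sum_(x : F) x ^+ k = 0.
Proof.
move=> kq; have [k0|k0] := posnP k.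
  rewrite k0; under eq_bigr do rewrite expr0.
  rewrite sumr_const; apply/eqP; rewrite -(dvdn_pcharf chF).
  rewrite (_ : #|_| = #|F|) // cardF; apply: dvdn_exp => //.
  by case: n cardF (finNzRing_gt1 F) => [->|].
have [a a0 ak] : exists2 a : F, a != 0 & a ^+ k != 1.
  have [/existsP[a /andP[a0 ak]]|/existsPn H] :=
    boolP [exists a : F, (a != 0) && (a ^+ k != 1)]; first by exists a.
  pose s := enum [pred a : F | a != 0].
  have nz1 : 'X^k - 1 != 0 :> {poly F} by rewrite -size_poly_eq0 size_Xn_sub_1.
  have rs : all (root ('X^k - 1)) s.
    apply/allP => a; rewrite mem_enum inE => a0; have := H a.
    by rewrite a0 negbK => /eqP ak; rewrite rootE !hornerE ak subrr.
  have := max_poly_roots nz1 rs (enum_uniq _).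
  by rewrite size_Xn_sub_1 // -cardE (cardC1 (0 : F)) ltnS leqNgt kq.
have aS : \sum_(x : F) x ^+ k = a ^+ k * \sum_(x : F) x ^+ k.
  rewrite mulr_sumr [LHS](reindex_inj (mulfI a0)).
  by apply: eq_bigr => x _; rewrite exprMn.
apply/eqP; apply: contraNT ak => S0; apply/eqP/(mulIf S0).
by rewrite -aS mul1r.
Qed.

Lemma sum_horner (q : {poly F}) : (size q <= #|F|.-1)%N -> \sum_x q.[x] = 0.
Proof.
move=> sq; under eq_bigr do rewrite horner_coef.
rewrite exchange_big big1 //= => i _.
by rewrite -mulr_sumr sum_expr ?mulr0 // (leq_trans _ sq).
Qed.

Lemma sum_horner_nz (q : {poly F}) :
  (size q <= #|F|.-1)%N -> \sum_(x | x != 0) q.[x] = - q.[0].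
Proof.
move=> /sum_horner; rewrite (bigD1 0) //= => /eqP.
by rewrite addrC addr_eq0 => /eqP.
Qed.

(** Multiplication by the nonzero elements of the prime field moves the
    hyperplane of trace t through all p - 1 hyperplanes of nonzero trace, and
    p - 1 = -1 in F. *)
Lemma sum_trace_hyperplane (phi : F -> F) (t : F) :
    t ^+ p = t -> t != 0 ->
    (forall c y, c ^+ p = c -> c != 0 -> phi (c * y) = phi y) ->
    (forall y, Tr y = 0 -> phi y = 0) ->
  \sum_(y | Tr y == t) phi y = - \sum_(y | y != 0) phi y.
Proof.
move=> tp t0 phiZ phi0.
have -> : \sum_(y | y != 0) phi y = \sum_(y | Tr y != 0) phi y.
  rewrite big_mkcond [RHS]big_mkcond; apply: eq_bigr => y _.
  have [->|y0] := eqVneq y 0; first by rewrite trace0 eqxx.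
  by have [/phi0|] := eqVneq (Tr y) 0.
rewrite [X in - X](partition_big Tr (fun c => (c ^+ p == c) && (c != 0))) /=; last first.
  by move=> y y0; rewrite trace_fixed eqxx.
rewrite [X in - X](eq_bigr (fun=> \sum_(y | Tr y == t) phi y)); last first.
  move=> c /andP[/eqP cp c0].
  have ctp : (c / t) ^+ p = c / t by rewrite expr_div_n cp tp.
  have ct0 : c / t != 0 by rewrite mulf_neq0 ?invr_eq0.
  rewrite [LHS](reindex_inj (mulfI ct0)) /=; apply: eq_big => [y|y _]; last exact: phiZ.
  rewrite traceZ // mulf_eq0 (negPf ct0) /=.
  have -> : (c / t * Tr y == c) = (Tr y == t).
    by rewrite -{2}(mulfVK t0 c) (inj_eq (mulfI ct0)).
  by have [->|] := eqVneq (Tr y) t; rewrite ?andbF // t0.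
rewrite sumr_const card_frobenius_fixed_nz.
set s := \sum_(y | _) _; apply/eqP; rewrite -subr_eq0 opprK -mulrS.
by rewrite prednK ?prime_gt0 // -mulr_natr (pcharf0 chF) mulr0.
Qed.

(** Splitting off the first term of the trace makes Tr(y) / y a polynomial in y
    with constant term 1. *)
Lemma trace_poly : (1 < n)%N -> exists2 u : {poly F},
  u.[0] = 1 /\ (size u + p <= (p ^ n.-1).+1)%N &
  forall y, Tr y = y + y ^+ p * u.[y].
Proof.
move=> n_gt1; have p1 := prime_gt1 pr_p.
case: n n_gt1 => [|[|m]] // _.
have pm i : (p <= p ^ i.+1)%N by rewrite expnS leq_pmulr // expn_gt0 prime_gt0.
exists (\sum_(i < m.+1) 'X^(p ^ i.+1 - p)) => [|y]; first split.
- rewrite horner_sum big_ord_recl /= expn1 subnn expr0 hornerC big1 ?addr0 // => i _.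
  rewrite hornerXn /bump /= expr0n subn_eq0 leqNgt add1n.
  by rewrite -{1}(expn1 p) ltn_exp2l.
- suff : (size (\sum_(i < m.+1) 'X^(p ^ i.+1 - p) : {poly F})%R
            <= (p ^ m.+1 - p).+1)%N.
    by move=> H; rewrite /= -(subnK (pm m)) -addSn leq_add2r.
  apply: leq_trans (size_sum _ _ _) _; apply/bigmax_leqP => i _.
  by rewrite size_polyXn ltnS leq_sub2r // leq_exp2l //.
- rewrite /trace big_ord_recl expn0 expr1 horner_sum mulr_sumr.
  congr (_ + _); apply: eq_bigr => i _; by rewrite hornerXn -exprD subnKC ?pm.
Qed.

(** Each summand is made homogeneous of degree 0 by a power of Tr(y) / t, which is
    1 on the hyperplane.  The sum over all nonzero y is then that of a polynomial
    of degree below q - 1, except that the third one also involves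
    y^(-(p-1)), which sums to 0. *)
Lemma trace_hyperplane_sums (t : F) : (1 < n)%N -> t ^+ p = t -> t != 0 ->
  [/\ \sum_(y | Tr y == t) (1 : F) = 0,
      t ^+ 2 * (\sum_(y | Tr y == t) y^-1 ^+ 2) = 1,
      t ^+ 2 * (\sum_(y | Tr y == t) y^-1 ^+ p.+1) = 2 &
      \sum_(y | Tr y == t) y^-1 ^+ p.-1 = 1].
Proof.
move=> n_gt1 tp t0; have p1 := prime_gt1 pr_p.
have [u [u0 su] Tu] := trace_poly n_gt1.
set m := (p ^ n.-1)%N in su.
have qE : #|F| = (p * m)%N by rewrite cardF /m -expnS prednK //; lia.
have pm : (p <= m)%N.
  by rewrite /m -(ltn_predK n_gt1) -{1}(expn1 p) leq_exp2l //; lia.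
have q2 : (2 * m <= #|F|)%N by rewrite qE leq_mul2r p1 orbT.
have {}su : (size u <= m.+1 - p)%N by rewrite leq_subRL 1?addnC //; lia.
pose w : {poly F} := 1 + 'X^(p.-1) * u.
have Tw y : Tr y = y * w.[y].
  rewrite Tu !hornerE mulrDr mulr1 mulrA -exprS prednK //; lia.
have w0 : w.[0] = 1 by rewrite !hornerE expr0n (_ : p.-1 == 0%N = false) ?mul0r ?addr0 //; lia.
have sw : (size w <= m)%N.
  apply: size_polyD_leq; first by rewrite size_poly1; lia.
  apply: (@size_polyM_leq _ p (m.+1 - p)) su _; last by lia.
  by rewrite size_polyXn prednK // ltnW.
have ratioZ c y : c ^+ p = c -> c != 0 -> Tr (c * y) / (c * y) = Tr y / y.
  by move=> cp c0; rewrite traceZ // invfM mulrACA divff // mul1r.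
have tp1 : t ^+ p.-1 = 1 := expf_eq1_pred tp t0.
have ratioE y : y != 0 -> Tr y / y = w.[y].
  by move=> y0; rewrite Tw mulrAC divff // mul1r.
have swX k : (0 < k)%N -> (size (w ^+ k) <= (m.-1 * k).+1)%N.
  move=> k0; apply: leq_trans (size_poly_exp_leq _ _) _.
  by rewrite ltnS leq_mul2r; apply/orP; right; lia.
have ratio_sum k : (0 < k)%N -> ((m.-1 * k).+1 < #|F|)%N ->
    \sum_(y | Tr y == t) (Tr y / y) ^+ k = 1.
  move=> k0 kq; rewrite (sum_trace_hyperplane (phi := fun y => (Tr y / y) ^+ k) tp t0).
  - under eq_bigr => y y0 do rewrite ratioE // -horner_exp.
    rewrite sum_horner_nz ?horner_exp ?w0 ?expr1n ?opprK //.
    by apply: leq_trans (swX k k0) _; lia.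
  - by move=> c y cp c0; rewrite ratioZ.
  - by move=> y ->; rewrite mul0r expr0n gtn_eqF.
split.
- transitivity (\sum_(y | Tr y == t) Tr y ^+ p.-1).
    by apply: eq_bigr => y /eqP->; rewrite tp1.
  rewrite (sum_trace_hyperplane (phi := fun y => Tr y ^+ p.-1) tp t0).
  + rewrite (eq_bigr (fun y => (('X * w) ^+ p.-1).[y])) => [|y _]; last first.
      by rewrite Tw horner_exp hornerM hornerX.
    rewrite sum_horner_nz.
      by rewrite horner_exp hornerM hornerX mul0r expr0n gtn_eqF ?oppr0 //; lia.
    apply: leq_trans (size_poly_exp_leq _ _) _.
    have sXw : ((size ('X * w)%R).-1 * p.-1 <= m * p.-1)%N.
      apply: leq_mul => //; rewrite -subn1 leq_subLR.
      by apply: size_polyM_leq (leqnn _) sw _; rewrite size_polyX.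
    by apply: leq_ltn_trans sXw _; rewrite qE; nia.
  + by move=> c y cp c0; rewrite traceZ // exprMn (expf_eq1_pred cp c0) mul1r.
  + by move=> y ->; rewrite expr0n (gtn_eqF _) //; lia.
- rewrite -[RHS](ratio_sum 2) //; last by lia.
  by rewrite mulr_sumr; apply: eq_bigr => y /eqP->; rewrite exprMn.
- rewrite mulr_sumr.
  transitivity (\sum_(y | Tr y == t) Tr y ^+ 2 * y^-1 ^+ p.+1).
    by apply: eq_bigr => y /eqP->.
  rewrite (sum_trace_hyperplane (phi := fun y => Tr y ^+ 2 * y^-1 ^+ p.+1) tp t0).
  + rewrite (eq_bigr (fun y => y^-1 ^+ p.-1 + (2 *: u + 'X^(p.-1) * u ^+ 2).[y])).
      rewrite big_split /= sum_horner_nz; last first.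
        apply: size_polyD_leq.
          by apply: leq_trans (size_scale_leq _ _) _; rewrite (leq_trans su) //; lia.
        apply: (@size_polyM_leq _ p (m.+1 - p + (m - p))); last by lia.
          by rewrite size_polyXn prednK // ltnW.
        by rewrite expr2 (size_polyM_leq su su) //; lia.
      rewrite (reindex_inj (@invr_inj F)) /=.
      under eq_bigl => y do rewrite invr_eq0.
      under eq_bigr => y y0 do rewrite invrK -hornerXn.
      rewrite sum_horner_nz ?size_polyXn; last by lia.
      have p1' : (0 < p.-1)%N by lia.
      rewrite hornerD hornerZ hornerM !hornerXn u0 expr0n gtn_eqF //=.
      by rewrite oppr0 add0r mul0r addr0 mulr1 opprK.
    move=> y y0; rewrite Tu hornerD hornerZ hornerM hornerXn horner_exp.
    have eX x : x ^+ p = x * x ^+ p.-1 by rewrite -exprS prednK // ltnW.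
    rewrite [y^-1 ^+ p.+1]exprS !eX exprVn; have := expf_neq0 p.-1 y0.
    by move: (y ^+ p.-1) => z z0; field; rewrite y0 z0.
  + move=> c y cp c0; rewrite traceZ // invfM [(c^-1 * _) ^+ _]exprMn.
    rewrite [c^-1 ^+ _]exprS exprVn cp; move: (_ ^+ p.+1) => z.
    by field.
  + by move=> y ->; rewrite expr0n mul0r.
- rewrite -[RHS](ratio_sum p.-1); try nia.
  by apply: eq_bigr => y /eqP->; rewrite exprMn tp1 mul1r.
Qed.

Lemma trace_hyperplane_map y : Tr (g y) = Tr y.
Proof. by rewrite traceB traceD trace_frob addrK. Qed.

(** * A permutation forces trace 1 or -1 *)

(** With the four sums above, the sum of g(y)^2 - y^2 over the hyperplane,
    multiplied by t^2, is 1 + 1 + 2 t^2 - 0 - 4. *)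
Lemma hyperplane_map_inj_trace_sq (t : F) :
    (1 < n)%N -> odd p -> t ^+ p = t -> t != 0 ->
    {in [set y | Tr y == t] &, injective g} -> t ^+ 2 = 1.
Proof.
move=> n1 op tp t0 g_inj; set S := [set y | Tr y == t] in g_inj.
have gS : [set g y | y in S] = S.
  apply/eqP; rewrite eqEcard card_in_imset // leqnn andbT.
  by apply/subsetP=> _ /imsetP[y yS ->]; move: yS; rewrite !inE trace_hyperplane_map.
have sum_sq : \sum_(y | Tr y == t) g y ^+ 2 = \sum_(y | Tr y == t) y ^+ 2.
  have inS P : \sum_(y | Tr y == t) P y = \sum_(y in S) P y :> F.
    by apply: eq_bigl => y; rewrite inE.
  by rewrite !inS -[in RHS]gS big_imset.
have [s1 s2 sp1 sp] := trace_hyperplane_sums n1 tp t0.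
have sq_expand y : Tr y == t -> g y ^+ 2 - y ^+ 2 =
    (y^-1 ^+ 2) ^+ p + y^-1 ^+ 2 + 2 * y^-1 ^+ p.-1 - 2 * 1 - 2 * y^-1 ^+ p.+1.
  move=> /eqP Ty; have y0 : y != 0.
    by apply: contraNneq t0 => y0; rewrite -Ty y0 trace0.
  have -> : (y^-1 ^+ 2) ^+ p = (y^-1 ^+ p) ^+ 2 by rewrite -!exprM mulnC.
  have eX (x : F) : x ^+ p = x * x ^+ p.-1 by rewrite -exprS prednK // prime_gt0.
  rewrite /hyperplane_map [y^-1 ^+ p.+1]exprS !eX.
  by move: (y^-1 ^+ p.-1) => z; field.
move/eqP: sum_sq; rewrite -subr_eq0 -sumrB (eq_bigr _ sq_expand).
rewrite 2!sumrB 2!big_split /= -frob_sum // -!mulr_sumr s1 sp => /eqP sum0.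
set A := \sum_(y | _) y^-1 ^+ 2 in s2 sum0.
set A1 := \sum_(y | _) y^-1 ^+ p.+1 in sp1 sum0.
have Ap : t ^+ 2 * A ^+ p = 1.
  by rewrite -{1}tp -exprM mulnC exprM -exprMn s2 expr1n.
have two0 : (2 : F) != 0.
  rewrite -(dvdn_pcharf chF); apply: contraL op => /dvdn_leq-/(_ isT) p2.
  by rewrite (_ : p = 2%N) //; have := prime_gt1 pr_p; lia.
apply: (mulfI two0); apply/eqP; rewrite mulr1 -subr_eq0; apply/eqP.
transitivity (t ^+ 2 * (A ^+ p + A + 2 * 1 - 2 * 0 - 2 * A1)
  - (t ^+ 2 * A ^+ p - 1) - (t ^+ 2 * A - 1) + 2 * (t ^+ 2 * A1 - 2)); first by ring.
by rewrite sum0 Ap s2 sp1; ring.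
Qed.

(** Explicit solution: with s_i the sum of the first i conjugates of y, the element
    z = sum of s_i b^(p^i) satisfies z^p - z = - y Tr(b), because the sum
    telescopes once s_n = Tr(y) = 0. *)
Lemma hilbert90 (b y : F) :
  Tr b != 0 -> Tr y = 0 -> exists x, x ^+ p - x = y.
Proof.
move=> Tb Ty; pose s i := \sum_(0 <= j < i) y ^+ (p ^ j).
have sS i : s i ^+ p = s i.+1 - y.
  rewrite /s big_nat_recl // expn0 expr1 addrAC subrr add0r frob_sum.
  by apply: eq_bigr => j _; rewrite -exprM -expnSr.
have sn : s n = 0 by rewrite /s big_mkord.
pose z := \sum_(0 <= i < n) s i * b ^+ (p ^ i).
have bn : b ^+ (p ^ n) = b by rewrite -cardF expf_card.
have zp : z ^+ p - z = - (y * Tr b).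
  have -> : z ^+ p = \sum_(0 <= i < n) (s i.+1 - y) * b ^+ (p ^ i.+1).
    rewrite frob_sum; apply: eq_bigr => i _.
    by rewrite exprMn sS -exprM -expnSr.
  rewrite /trace -(big_mkord xpredT (fun i => b ^+ (p ^ i))) mulr_sumr -sumrB.
  transitivity (\sum_(0 <= i < n)
     (((s i.+1 - y) * b ^+ (p ^ i.+1) - (s i - y) * b ^+ (p ^ i))
       - y * b ^+ (p ^ i))).
    by apply: eq_bigr => i _; ring.
  rewrite sumrB (telescope_sumr (fun i => (s i - y) * b ^+ (p ^ i))) //.
  by rewrite bn sn expn0 expr1 /s big_geq // subrr sub0r.
exists (- z / Tr b).
rewrite expr_div_n trace_fixed -mulrBl.
have -> : (- z) ^+ p - - z = - (z ^+ p - z).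
  by rewrite frobN; ring.
by rewrite zp opprK mulfK.
Qed.

(** If g agrees at two points lifted to x1 and x2, then f_b(x1) - f_b(x2) lies in
    the prime field.  Since f_b commutes with translations by the prime field,
    x1 - x2 lies there too, and x1, x2 lift the same point. *)
Lemma bijective_f_b_hyperplane_map_inj (b : F) : Tr b != 0 ->
  bijective (f_b p b) -> {in [set y | Tr y == Tr b] &, injective g}.
Proof.
move=> Tb /bij_inj f_inj y1 y2; rewrite !inE => /eqP T1 /eqP T2 g12.
have lift y : Tr y = Tr b -> exists x, y = x ^+ p - x + b.
  move=> Ty; have [|x xE] := hilbert90 (y := y - b) Tb.
    by rewrite traceB Ty subrr.
  by exists x; rewrite xE subrK.
have [[x1 y1E] [x2 y2E]] := (lift _ T1, lift _ T2).
have fE x y : y = x ^+ p - x + b -> f_b p b x ^+ p - f_b p b x = g y - b.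
  by move=> ->; rewrite /f_b frobD /hyperplane_map; ring.
pose c := f_b p b x1 - f_b p b x2.
have cp : c ^+ p = c.
  apply/eqP; rewrite -subr_eq0 frobB; apply/eqP.
  transitivity ((f_b p b x1 ^+ p - f_b p b x1) - (f_b p b x2 ^+ p - f_b p b x2)).
    by rewrite /c; ring.
  by rewrite (fE _ _ y1E) (fE _ _ y2E) g12 subrr.
have yE : (x2 + c) ^+ p - (x2 + c) + b = y2.
  by rewrite frobD cp y2E; ring.
have /f_inj x12 : f_b p b x1 = f_b p b (x2 + c).
  rewrite {2}/f_b yE; have -> : x2 + c + y2^-1 = f_b p b x2 + c.
    by rewrite /f_b -y2E; ring.
  by rewrite /c; ring.
by rewrite y1E x12 yE.
Qed.

(** * A collision in the quadratic subfield *)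

(** By parity of n, 2 (p - 1) divides q - 1, so X^2 - c divides X^q - X,
    which splits in F. *)
Lemma frobenius_fixed_sqrt (c : F) :
  odd p -> ~~ odd n -> c ^+ p = c -> exists z, z ^+ 2 = c.
Proof.
move=> op on cp; have [->|c0] := eqVneq c 0; first by exists 0; rewrite expr0n.
have p1 := prime_gt1 pr_p.
have [k qE] : exists k, (#|F|.-1 = 2 * p.-1 * k)%N.
  have nE : n = (2 * n./2)%N by have := odd_double_half n; rewrite (negPf on); lia.
  rewrite cardF nE expnM; have := dvdn_pred_predX (p ^ 2) n./2.
  have -> : ((p ^ 2).-1 = 2 * p.-1 * p.+1./2)%N.
    by have := odd_double_half p.+1; rewrite /= op /= -muln2; nia.
  by case/dvdnP=> j ->; exists (p.+1./2 * j)%N; lia.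
have ck : c ^+ (p.-1 * k) = 1 by rewrite exprM (expf_eq1_pred cp c0) expr1n.
have q0 : (0 < #|F|)%N := ltnW (finNzRing_gt1 F).
have : 'X^2 - c%:P %| \prod_(x : F) ('X - x%:P).
  rewrite -finField_genPoly -(prednK q0) qE [X in _ %| X - _]exprS -[X in _ - X]mulr1 -mulrBr.
  rewrite dvdp_mull // -mulnA exprM -(rmorph1 polyC) -ck rmorphXn subrXX.
  by rewrite dvdp_mulr.
case/dvdp_prod_XsubC=> m; set r := mask m _ => eq_r.
have : size r = 2.
  have := eqp_size eq_r; rewrite size_XnsubC // size_prod_XsubC.
  by case.
case: r eq_r => [|z r] // eq_r _.
exists z; apply/eqP; rewrite -subr_eq0.
have := eqp_root eq_r z.
by rewrite big_cons rootM root_XsubC eqxx /= rootE !hornerE => ->.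
Qed.
End FiniteField.

Section QuarticExtension.
Variables (F : finFieldType) (p : nat).
Hypotheses (pr_p : prime p) (cardF : #|F| = (p ^ 4)%N) (p_gt10 : (10 < p)%N).
Let chF : p \in [pchar F] := card_finPcharP cardF pr_p.

Let odd_p : odd p.
Proof. by case: (even_prime pr_p) => // p2; move: p_gt10; rewrite p2. Qed.

Lemma trace4_quadratic (u : F) :
  u ^+ p ^+ p = u -> trace p 4 u = 2 * (u + u ^+ p).
Proof.
move=> upp; rewrite /trace !big_ord_recl big_ord0 /= expn0 expn1 expr1.
rewrite -[bump 0 1]/(2%N) -[bump 0 (bump 0 1)]/(3%N).
have -> : u ^+ (p ^ 2) = u by rewrite -mulnn exprM upp.
have -> : u ^+ (p ^ 3) = u ^+ p by rewrite expnS mulnC exprM -mulnn exprM upp.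
ring.
Qed.

Lemma sqrt_of_nonsquare (v sigma : F) :
  v ^+ p./2 = -1 -> sigma ^+ 2 = v -> sigma ^+ p = - sigma.
Proof.
move=> ve sv; rewrite -(odd_double_half p) odd_p exprD -mul2n exprM sv ve.
by rewrite expr1 mulrN1.
Qed.

(** The points are u1, u2 = (s + W + a) / 2, (s + W - a) / 2 with s = t/2 and W, a
    anti-invariant under Frobenius.  With Z = 4 (r^2 + c) / (r^2 - c) one has
    Z^2 - W^2 = 16, and the norm condition on u1 u2 + 1 amounts to
    4 a^2 = (2 Z - 1)^2 - 48, whose right-hand side is the quartic in r over
    (r^2 - c)^2.  Here c is called gamma; a nonsquare value of the quartic is what
    makes a anti-invariant. *)
Lemma hyperplane_map_collision (t : F) : t ^+ p = t -> t ^+ 2 = 1 ->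
  exists u1 u2 : F, [/\ trace p 4 u1 = t, trace p 4 u2 = t, u1 != u2 &
    hyperplane_map p u1 = hyperplane_map p u2].
Proof.
move=> tp t2.
have natF k : (k%:R : F) ^+ p = k%:R by rewrite -(pFrobenius_autE chF) rmorph_nat.
have nat_neq0 k : (0 < k < p)%N -> (k%:R : F) != 0.
  case/andP=> k0 kp; rewrite -(dvdn_pcharf chF).
  by apply/negP=> /(dvdn_leq k0); rewrite leqNgt kp.
have two0 : (2 : F) != 0 by apply: nat_neq0; lia.
have four0 : (4 : F) != 0 by apply: nat_neq0; lia.
have sixteen0 : (16 : F) != 0.
  by rewrite (natrM F 4 4) mulf_neq0.
have three0 : (3 : F) != 0 by apply: nat_neq0; lia.
have nonsquare0 : (0 : F) ^+ 2 ^+ p./2 != -1.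
  rewrite expr0n expr0n gtn_eqF; last by lia.
  by rewrite eq_sym oppr_eq0 oner_eq0.
have sqrtK (v : F) : v ^+ p = v -> exists z, z ^+ 2 = v.
  exact: (frobenius_fixed_sqrt pr_p cardF).
(* A square root of a nonsquare of the prime field is anti-invariant; a value of
   X^4 + 1 provides the nonsquare. *)
have [eps epsp eps0] : exists2 eps : F, eps ^+ p = - eps & eps != 0.
  have [|||r rp nsq] := quartic_nonsquare_value chF (B := 0) (C := 1) p_gt10.
  - by rewrite expr0n mulr1 eq_sym nat_neq0 //; lia.
  - by rewrite expr0n gtn_eqF // prime_gt0.
  - by rewrite expr1n.
  have [|eps eps2] := sqrtK (r ^+ 4 + 0 * r ^+ 2 + 1).
    by rewrite mul0r addr0 (frobD pr_p cardF) expr1n exprAC rp.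
  exists eps; first exact: sqrt_of_nonsquare nsq eps2.
  by apply/eqP=> e0; move: nsq; rewrite -eps2 e0; apply/eqP/nonsquare0.
have [gamma gE] : exists gamma, gamma = eps ^+ 2 by exists (eps ^+ 2).
have gp : gamma ^+ p = gamma by rewrite gE exprAC epsp sqrrN.
(* The factored coefficient 6 * 37 = 222 and 33 come from expanding
   (7 r^2 + 9 gamma)^2 - 48 (r^2 - gamma)^2. *)
have Bp : (6 * 37 * gamma) ^+ p = 6 * 37 * gamma by rewrite !exprMn gp !natF.
have Cp : (33 * gamma ^+ 2) ^+ p = 33 * gamma ^+ 2.
  by rewrite exprMn natF exprAC gp.
have [|||r rp nsq] := quartic_nonsquare_value chF
  (B := 6 * 37 * gamma) (C := 33 * gamma ^+ 2) p_gt10.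
- have g0 : gamma != 0 by rewrite gE expf_neq0.
  rewrite -subr_eq0.
  have -> : (6 * 37 * gamma) ^+ 2 - 4 * (33 * gamma ^+ 2)
             = 2 ^+ 14 * 3 * gamma ^+ 2 by ring.
  by rewrite !(mulf_neq0, expf_neq0).
- exact: Bp.
- exact: Cp.
set v := r ^+ 4 + _ + _ in nsq.
have [|sigma sigma2] := sqrtK v.
  rewrite /v 2!(frobD pr_p cardF) [(_ * r ^+ 2) ^+ p]exprMn Bp Cp.
  by rewrite -[r ^+ 4 ^+ p]exprAC -[r ^+ 2 ^+ p]exprAC rp.
have sigmap := sqrt_of_nonsquare nsq sigma2.
have sigma0 : sigma != 0.
  by apply/eqP=> e0; move: nsq; rewrite -sigma2 e0; apply/eqP/nonsquare0.
pose D := r ^+ 2 - gamma.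
have D0 : D != 0.
  rewrite subr_eq0 gE eqf_sqr; apply/negP=> /orP re.
  have r0 : r = 0.
    have rN : r = - r.
      by case: re rp => /eqP->; rewrite ?(frobN pr_p cardF) epsp ?opprK.
    by apply: (mulfI two0); rewrite mulr0 mulr_natl mulr2n {2}rN subrr.
  by case: re; rewrite r0 eq_sym ?oppr_eq0 (negPf eps0).
have Dp : D ^+ p = D.
  by rewrite /D (frobB pr_p cardF) gp exprAC rp.
pose W := 8 * r * eps / D; pose a := sigma / (2 * D).
have Wp : W ^+ p = - W.
  by rewrite /W expr_div_n !exprMn natF rp epsp Dp mulrN mulNr.
have ap : a ^+ p = - a by rewrite /a expr_div_n exprMn natF sigmap Dp mulNr.
have a0 : a != 0 by rewrite mulf_neq0 ?invr_eq0 ?mulf_neq0.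
pose s := t / 2.
have sp : s ^+ p = s by rewrite /s expr_div_n natF tp.
pose u1 := (s + W + a) / 2; pose u2 := (s + W - a) / 2.
have u1p : u1 ^+ p = (s - W - a) / 2.
  by rewrite expr_div_n natF !(frobD pr_p cardF) sp Wp ap.
have u2p : u2 ^+ p = (s - W + a) / 2.
  by rewrite expr_div_n natF (frobB pr_p cardF) (frobD pr_p cardF) sp Wp ap opprK.
have Tu1 : trace p 4 u1 = t.
  rewrite trace4_quadratic u1p; first by rewrite /u1 /s; field.
  by rewrite expr_div_n natF 2!(frobB pr_p cardF) sp Wp ap !opprK.
have Tu2 : trace p 4 u2 = t.
  rewrite trace4_quadratic u2p; first by rewrite /u2 /s; field.
  by rewrite expr_div_n natF (frobD pr_p cardF) (frobB pr_p cardF) sp Wp ap opprK.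
have t0 : t != 0 by rewrite -sqrf_eq0 t2 oner_eq0.
have nz u : trace p 4 u = t -> u != 0.
  by move=> Tu; apply: contraNneq t0 => u0; rewrite -Tu u0 (trace0 pr_p cardF).
have u10 := nz _ Tu1; have u20 := nz _ Tu2.
have u1p0 : u1 ^+ p != 0 by rewrite expf_neq0.
have u2p0 : u2 ^+ p != 0 by rewrite expf_neq0.
have norm1 : (u1 * u2 + 1) * (u1 ^+ p * u2 ^+ p + 1) = 1.
  have W2 : W ^+ 2 = 64 * r ^+ 2 * gamma / D ^+ 2 by rewrite /W gE; field.
  have a2 : a ^+ 2 = v / (4 * D ^+ 2).
    by rewrite /a -sigma2; field; rewrite D0 four0 two0.
  have s2 : s ^+ 2 = 1 / 4 by rewrite /s expr_div_n t2 -natrX.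
  transitivity (((4 + s ^+ 2 + W ^+ 2 - a ^+ 2) ^+ 2 - 4 * s ^+ 2 * W ^+ 2) / 16).
    by rewrite u1p u2p /u1 /u2; field; rewrite sixteen0 two0.
  rewrite s2 W2 a2 /v; move: D0; rewrite /D => D0.
  by field; rewrite sixteen0 D0 four0.
exists u1, u2; split=> //.
  by rewrite -subr_eq0 (_ : u1 - u2 = a) // /u1 /u2; field.
apply/eqP; rewrite -subr_eq0; apply/eqP.
have au : u1 - u2 = a by rewrite /u1 /u2; field.
have aup : u2 ^+ p - u1 ^+ p = a by rewrite u1p u2p; field.
transitivity (((u1 - u2) * (u1 * u2) * (u1 ^+ p * u2 ^+ p)
    + (u2 ^+ p - u1 ^+ p) * (u1 * u2) + (u1 - u2) * (u1 ^+ p * u2 ^+ p))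
    / (u1 * u2 * (u1 ^+ p * u2 ^+ p))).
  rewrite /hyperplane_map !exprVn; move: u1p0 u2p0.
  by move: (u1 ^+ p) (u2 ^+ p) => x1 x2 x10 x20; field; rewrite u10 u20 x10 x20.
rewrite au aup.
transitivity (a * ((u1 * u2 + 1) * (u1 ^+ p * u2 ^+ p + 1) - 1)
   / (u1 * u2 * (u1 ^+ p * u2 ^+ p))); first by congr (_ / _); ring.
by rewrite norm1 subrr mulr0 mul0r.
Qed.

(** * Failure of bijectivity *)

Lemma f_b_not_bijective (b : F) : trace p 4 b != 0 -> ~ bijective (f_b p b).
Proof.
move=> Tb f_bij.
have g_inj := bijective_f_b_hyperplane_map_inj pr_p cardF Tb f_bij.
have Tp := trace_fixed pr_p cardF b.
have T2 := hyperplane_map_inj_trace_sq pr_p cardF (isT : 1 < 4)%N odd_p Tp Tb g_inj.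
have [u1 [u2 [Tu1 Tu2 /eqP u12 g12]]] := hyperplane_map_collision Tp T2.
by apply: u12; apply: g_inj; rewrite ?inE ?Tu1 ?Tu2.
Qed.
End QuarticExtension.

Lemma leq_of_uint_acc d acc : (acc <= Nat.of_uint_acc d acc)%N.
Proof.
have tm a : (a <= Nat.tail_mul 10 a)%N.
  by rewrite PeanoNat.Nat.tail_mul_spec multE leq_pmull.
by elim: d acc => //= d IH acc; apply: leq_trans (IH _); do ?apply: leqW; apply: tm.
Qed.

(** A decimal literal with nine digits must never be expanded in unary; its
    first three digits suffice to compare it with 10. *)
Lemma decimal_100_gt10 d :
  (10 < Nat.of_num_uint (Number.UIntDecimal
           (Decimal.D1 (Decimal.D0 (Decimal.D0 d)))))%N.
Proof. exact: leq_trans (leq_of_uint_acc d 100). Qed.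

Theorem theorem4p1 (p : nat) (F : finFieldType) (b : F) :
  prime p -> (100018663 <= p)%N -> #|F| = (p ^ 4)%N ->
  trace p 4 b != 0 ->
  ~ bijective (f_b p b).
Proof.
move=> pr_p /(leq_trans (decimal_100_gt10 _)) p_gt10 cardF.
exact: f_b_not_bijective pr_p cardF p_gt10 b.
Qed.
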